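(* Let $f$ be any honest function and let $b\geq 2$ be any base. Then the base-$b$ sum approximation from below $\hat{A}^{\alpha^f}_b$ of $\alpha^f$ is elementary.
   Context: A function $\phi$ is elementary if it can be generated from the initial functions $2^x$, $\max$, $0$, $S$ (successor) and the projections $I^n_i$ by composition and bounded primitive recursion; a relation is elementary if its characteristic function is. Rationals are coded into $\mathbb{N}$ in a standard elementary way. A function $f:\mathbb{N}\to\mathbb{N}$ is honest if $f(x)\le f(x+1)$, $f(x)\geq 2^x$ for all $x$, and the relation $f(x)=y$ is elementary. Let $P_i$ denote the $i$-th prime ($P_0=2,P_1=3,\dots$). Define $g(0)=1$ and $g(j+1)=P_j^{2(j+2)(g(j)+1)^3}$. For an honest $f$ let $h(i)=g(f(i)+i)$, $\alpha^f_n=\sum_{i=0}^n P_i^{-h(i)}$ and $\alpha^f=\lim_{n\to\infty}\alpha^f_n$ (an irrational number in $(0,1)$). For an irrational $\alpha\in(0,1)$ and base $b\ge2$, write uniquely $\alpha=\sum_{i=1}^\infty\mathtt{D}_ib^{-k_i}$ with $\mathtt{D}_i\in\{1,\dots,b-1\}$ and $0<k_1<k_2<\cdots$; then $\hat{A}^\alpha_b(0)=0$ and $\hat{A}^\alpha_b(i)=\mathtt{D}_ib^{-k_i}$ for $i>0$. *)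

(* Defs.v *)
From HB Require Import structures.
From mathcomp Require Import all_boot all_order all_algebra.
From mathcomp Require Import zify ring lra.
From mathcomp Require Import all_classical all_reals all_analysis.

Set Implicit Arguments.
Unset Strict Implicit.
Unset Printing Implicit Defensive.

Import Order.TTheory GRing.Theory Num.Theory.
Import numFieldNormedType.Exports.

Local Open Scope classical_set_scope.
Local Open Scope ring_scope.

(* The recursion argument comes first; the parameters are v. The constant 0 is
   nullary, so el_comp with m = 0 yields the n-ary zero functions. *)
Inductive elementary : forall n : nat, (n.-tuple nat -> nat) -> Prop :=
| el_exp2 : @elementary 1 (fun v => (2 ^ tnth v ord0)%N)
| el_max : @elementary 2 (fun v => maxn (tnth v ord0) (tnth v ord_max))
| el_zero : @elementary 0 (fun=> 0%N)
| el_succ : @elementary 1 (fun v => (tnth v ord0).+1)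
| el_proj (n : nat) (i : 'I_n) : @elementary n (fun v => tnth v i)
| el_comp (m n : nat) (f : m.-tuple nat -> nat)
    (g : 'I_m -> n.-tuple nat -> nat) :
    elementary f -> (forall i, elementary (g i)) ->
    elementary (fun v => f [tuple g i v | i < m])
| el_bounded_rec (n : nat) (g : n.-tuple nat -> nat)
    (h : n.+2.-tuple nat -> nat) (j f : n.+1.-tuple nat -> nat) :
    elementary g -> elementary h -> elementary j ->
    (forall v : n.-tuple nat, f [tuple of 0%N :: v] = g v) ->
    (forall (y : nat) (v : n.-tuple nat),
       f [tuple of y.+1 :: v] =
       h [tuple of [:: y, f [tuple of y :: v] & v]]) ->
    (forall w, (f w <= j w)%N) ->
    elementary f.

Definition elementary_fun (f : nat -> nat) : Prop :=
  @elementary 1 (fun v => f (tnth v ord0)).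

Definition elementary_rel (r : rel nat) : Prop :=
  @elementary 2 (fun v => nat_of_bool (r (tnth v ord0) (tnth v ord_max))).

Definition cantor_pair (m n : nat) : nat := (((m + n) * (m + n).+1)./2 + n)%N.

Definition int_code (z : int) : nat :=
  match z with Posz n => n.*2 | Negz n => n.*2.+1 end.

Definition rat_code (q : rat) : nat :=
  cantor_pair (int_code (numq q)) `|denq q|%N.

Lemma cantor_pair_inj m n m' n' :
  cantor_pair m n = cantor_pair m' n' -> m = m' /\ n = n'.
Proof.
have mono p q p' q' : (p + q < p' + q')%N ->
    (cantor_pair p q < cantor_pair p' q')%N.
  rewrite /cantor_pair => lt_s; set s := (p + q)%N; set s' := (p' + q')%N.
  have : ((s.+1 * s.+2)./2 <= (s' * s'.+1)./2)%N.
    by rewrite half_leq// leq_mul.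
  have -> : (s.+1 * s.+2 = s.+1.*2 + s * s.+1)%N.
    by rewrite -[s.+2]addn2 mulnDr muln2 addnC mulnC.
  by rewrite halfD odd_double andFb add0n doubleK; lia.
move=> E; have Es : (m + n = m' + n')%N.
  by case: (ltngtP (m + n) (m' + n'))%N => // /mono; rewrite E ltnn.
by move: E; rewrite /cantor_pair Es => /addnI En; split=> //; lia.
Qed.

Lemma rat_code_inj : injective rat_code.
Proof.
move=> p q /cantor_pair_inj[En Ed].
have {}En : numq p = numq q.
  by move: En; case: (numq p) (numq q) => m [] n /=; lia.
have {}Ed : denq p = denq q by rewrite -(absz_denq p) -(absz_denq q) Ed.
by rewrite -(divq_num_den p) -(divq_num_den q) En Ed.
Qed.

Definition elementary_rat_fun (A : nat -> rat) : Prop :=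
  elementary_fun (fun i => rat_code (A i)).

Definition honest (f : nat -> nat) : Prop :=
  [/\ forall x, (f x <= f x.+1)%N,
      forall x, (2 ^ x <= f x)%N &
      elementary_rel (fun x y => f x == y)].

Lemma prime_above_ex (m : nat) : exists p, prime p && (m < p)%N.
Proof. by have [p mp pp] := prime_above m; exists p; rewrite pp mp. Qed.

Definition next_prime (m : nat) : nat := ex_minn (prime_above_ex m).

(* nth_prime 0 = 2, nth_prime 1 = 3, ... *)
Definition nth_prime (i : nat) : nat := iter i.+1 next_prime 0%N.

Fixpoint gtower (n : nat) : nat :=
  if n is j.+1 then (nth_prime j ^ (2 * (j + 2) * (gtower j + 1) ^ 3))%N
  else 1%N.

Definition hexp (f : nat -> nat) (i : nat) : nat := gtower (f i + i)%N.

Definition alpha_partial (R : realType) (f : nat -> nat) (n : nat) : R :=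
  \sum_(0 <= i < n.+1) (nth_prime i)%:R ^- hexp f i.

Definition alpha (R : realType) (f : nat -> nat) : R :=
  limn (alpha_partial R f).

(* A is the base-b sum approximation from below of x. The functions D and k
   are only relevant at indices i >= 1. By sum_approx_below_unique there is at
   most one such A. *)
Definition is_sum_approx_below (R : realType) (b : nat) (x : R)
    (A : nat -> rat) : Prop :=
  exists D k : nat -> nat,
  [/\ forall i, (1 <= i)%N -> (1 <= D i <= b - 1)%N,
      (0 < k 1)%N /\ (forall i, (1 <= i)%N -> (k i < k i.+1)%N),
      \sum_(1 <= i < n.+1) ((D i)%:R * b%:R ^- k i : R) @[n --> \oo] --> x &
      A 0%N = 0 /\
      (forall i, (1 <= i)%N -> A i = (D i)%:R * b%:R ^- k i)].

Section Uniqueness.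
Variables (R : realType) (b : nat).
Hypothesis b_ge2 : (2 <= b)%N.

Let S (D k : nat -> nat) n : R := \sum_(1 <= i < n.+1) ((D i)%:R * b%:R ^- k i).

Let bR_gt0 : 0 < b%:R :> R. Proof. by rewrite ltr0n; lia. Qed.

Let pow_le (m n : nat) : (m < n)%N -> b%:R * b%:R ^- n <= b%:R ^- m :> R.
Proof.
case: n => // n; rewrite ltnS => mn.
rewrite exprS invfM mulrA divff ?gt_eqF// mul1r lef_pV2 ?posrE ?exprn_gt0//.
by rewrite ler_eXn2l// ltr1n.
Qed.

Let remainder_bounds (D k : nat -> nat) (x : R) :
  (forall i, (1 <= i)%N -> (1 <= D i <= b - 1)%N) ->
  (forall i, (1 <= i)%N -> (k i < k i.+1)%N) ->
  S D k @ \oo --> x ->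
  forall n, (D n.+1)%:R * b%:R ^- k n.+1 < x - S D k n
            <= ((D n.+1)%:R + 1) * b%:R ^- k n.+1.
Proof.
move=> HD Hk Hx n.
have SS m : S D k m.+1 = S D k m + (D m.+1)%:R * b%:R ^- k m.+1.
  by rewrite /S big_nat_recr.
have pw_gt0 m : 0 < b%:R ^- m :> R by rewrite invr_gt0 exprn_gt0.
have t_gt0 m : 0 < (D m.+1)%:R * b%:R ^- k m.+1 :> R.
  by rewrite mulr_gt0// ltr0n; have := HD m.+1 isT; lia.
have Sle m : S D k m <= x.
  have nd : {homo S D k : i j / (i <= j)%N >-> i <= j}.
    by apply/nondecreasing_seqP => i; rewrite SS lerDl ltW.
  rewrite -(cvg_lim _ Hx)//; apply: nondecreasing_cvgn_le => //.
  by apply/cvg_ex; exists x.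
have Sub m : S D k (n.+1 + m) + b%:R ^- k (n.+1 + m)%N
    <= S D k n.+1 + b%:R ^- k n.+1.
  elim: m => [|m IH]; first by rewrite addn0.
  apply: le_trans IH; rewrite addnS SS -addrA lerD2l.
  apply: le_trans (pow_le (Hk (n.+1 + m)%N isT)).
  rewrite -{2}[b%:R ^- k (n.+1 + m).+1]mul1r -mulrDl ler_pM2r//.
  by rewrite natr1 ler_nat; have := HD (n.+1 + m).+1 isT; lia.
apply/andP; split.
  by rewrite ltrBrDl -SS; apply: lt_le_trans (Sle n.+2); rewrite [ltRHS]SS ltrDl.
rewrite lerBlDl mulrDl mul1r addrA -SS -(cvg_lim _ Hx)//; apply: limr_le.
  by apply/cvg_ex; exists x.
exists n.+1 => // m /= nm; have := Sub (m - n.+1)%N.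
by rewrite subnKC//; apply: le_trans; rewrite lerDl ltW.
Qed.

Lemma sum_approx_below_unique (x : R) (A A' : nat -> rat) :
  is_sum_approx_below b x A -> is_sum_approx_below b x A' -> A =1 A'.
Proof.
move=> [D [k [HD [_ Hk] Hx [A0 HA]]]] [D' [k' [HD' [_ Hk'] Hx' [A0' HA']]]].
have B := remainder_bounds HD Hk Hx; have B' := remainder_bounds HD' Hk' Hx'.
have pw_gt0 m : 0 < b%:R ^- m :> R by rewrite invr_gt0 exprn_gt0.
have nlt (E E' l l' : nat) (r : R) : (1 <= E)%N -> (E' <= b - 1)%N ->
    E%:R * b%:R ^- l < r -> r <= (E'%:R + 1) * b%:R ^- l' -> (l' <= l)%N.
  move=> HE HE' lo hi; rewrite leqNgt; apply/negP => /pow_le ll.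
  have : b%:R ^- l < b%:R ^- l :> R; last by rewrite ltxx.
  apply: le_lt_trans (lt_le_trans lo (le_trans hi (le_trans _ ll))).
    by rewrite ler_peMl ?(ltW (pw_gt0 _))// ler1n.
  by rewrite ler_pM2r// natr1 ler_nat; lia.
have step n : S D k n = S D' k' n -> D n.+1 = D' n.+1 /\ k n.+1 = k' n.+1.
  move=> En; have := B n; have := B' n; rewrite -En.
  move=> /andP[lo' hi'] /andP[lo hi].
  have /andP[D1 D2] := HD n.+1 isT; have /andP[D1' D2'] := HD' n.+1 isT.
  have Ek : k n.+1 = k' n.+1.
    by apply/eqP; rewrite eqn_leq (nlt _ _ _ _ _ D1' D2 lo' hi)
      (nlt _ _ _ _ _ D1 D2' lo hi').
  split=> //; move: lo hi lo' hi'; rewrite Ek => lo hi lo' hi'.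
  have := lt_le_trans lo hi'; have := lt_le_trans lo' hi.
  by rewrite !ltr_pM2r// !natr1 !ltr_nat; lia.
have ES n : S D k n = S D' k' n.
  elim: n => [|n IH]; first by rewrite /S !big_geq.
  have [ED Ek] := step n IH.
  by rewrite /S !(@big_nat_recr _ _ _ n.+1)//= -/(S D k n) -/(S D' k' n) IH ED Ek.
case=> [|n]; first by rewrite A0 A0'.
by have [ED Ek] := step n (ES n); rewrite HA// HA'// ED Ek.
Qed.

End Uniqueness.

(* Main.v *)
Require Import Defs.
From mathcomp Require Import all_boot all_order all_algebra.
From mathcomp Require Import zify ring lra.
From mathcomp Require Import all_classical all_reals all_analysis.

(* Write a_j = P_j ^ h(j), M_n = \prod_(j < n) a_j, and N_n / M_n for the sum of
   the 1 / a_j with j < n. The tail of alpha beyond n is at most 2 / a_n, so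
   floor (b^k alpha) = floor (b^k N_n / M_n) as soon as 2 b^k M_n < a_n. Since
   h(n) >= 2 (h(0) + ... + h(n - 1)), it is enough that h(n) > 2 b k + 2, so one
   may take for n the number of indices j with h(j) < y := 2 b k + 3. Although h
   is not elementary, min(h(j), y) is elementary in j and y, hence so are M_n,
   N_n and the k-th digit of alpha as functions of k.
   For the position of the i-th nonzero digit to be found by a bounded search,
   an elementary bound is needed. If n > b, then P_(n-1) divides M_n but neither
   b nor N_n, so b^k N_n / M_n is never an integer, its fractional part is at
   least 1 / M_n, and any M_n consecutive digits contain a nonzero one. Hence
   the i-th nonzero digit occurs before position i M_n, provided the digits of
   N_n / M_n and alpha agree that far; as M_n ^ 2 <= h(n), this holds when h(n)
   is at least quadratic in i. *)

Set Implicit Arguments.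
Unset Strict Implicit.
Unset Printing Implicit Defensive.

Import Order.TTheory GRing.Theory Num.Theory.
Import numFieldNormedType.Exports.

Local Open Scope nat_scope.

(** * Closure properties of the elementary functions *)

(* Arguments are lists, so that variables are plain [nth 0 v i] and a bound
   variable is pushed in front of the list. *)
Definition elem (n : nat) (F : seq nat -> nat) : Prop :=
  elementary (fun v : n.-tuple nat => F v).

Lemma eq_elem n F G :
  (forall v, size v = n -> F v = G v) -> elem n F -> elem n G.
Proof.
move=> FG; rewrite /elem; congr elementary.
by apply/boolp.funext => v; rewrite FG// size_tuple.
Qed.

Lemma elem_of n (F : n.-tuple nat -> nat) (G : seq nat -> nat) :
  elementary F -> (forall v : n.-tuple nat, F v = G v) -> elem n G.
Proof. by move=> EF FG; rewrite /elem; have <- : F = G by apply/boolp.funext. Qed.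

Lemma elem_nth n i : elem n (fun v => nth 0 v i).
Proof.
have [lt_in|le_ni] := ltnP i n.
  apply: (elem_of (el_proj (Ordinal lt_in))) => v.
  by rewrite (tnth_nth 0).
(* Out of range the value is the default 0, obtained by composing the nullary zero with an empty
   family. *)
apply: (elem_of (@el_comp 0 n _ (fun _ _ => 0) el_zero _)).
  by case.
by move=> v; rewrite nth_default ?size_tuple.
Qed.

(** Under bound variables the parameters occur as iterated [behead]s of the argument list; this is
    the shape that [el_var] meets. *)
Lemma elem_var n d i : elem n (fun v => nth 0 (iter d behead v) i).
Proof.
apply: eq_elem (elem_nth n (i + d)) => v _.
by elim: d i => [|d IH] i /=; rewrite ?addn0// nth_behead -IH addSnnS.
Qed.

Lemma elem_comp m n (F : seq nat -> nat) (G : nat -> seq nat -> nat) :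
  elem m F -> (forall i, i < m -> elem n (G i)) ->
  elem n (fun v => F (mkseq (G^~ v) m)).
Proof.
move=> EF EG.
apply: (elem_of (@el_comp m n _ (fun i v => G i v) EF _)) => [i|v].
  exact: EG.
congr F; rewrite /mkseq -val_enum_ord -map_comp /=.
by [].
Qed.

Lemma elem_comp1 n (phi : nat -> nat) F :
  elem 1 (fun v => phi (nth 0 v 0)) -> elem n F -> elem n (fun v => phi (F v)).
Proof. by move=> Ephi EF; apply: (elem_comp (G := fun=> F) Ephi). Qed.

Lemma elem_comp2 n (phi : nat -> nat -> nat) F G :
  elem 2 (fun v => phi (nth 0 v 0) (nth 0 v 1)) -> elem n F -> elem n G ->
  elem n (fun v => phi (F v) (G v)).
Proof.
move=> Ephi EF EG.
by apply: (elem_comp (G := fun i => if i is 0 then F else G) Ephi); case.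
Qed.

Lemma elem_succ n F : elem n F -> elem n (fun v => (F v).+1).
Proof.
by apply: elem_comp1; apply: (elem_of el_succ) => v; rewrite (tnth_nth 0).
Qed.

Lemma elem_exp2 n F : elem n F -> elem n (fun v => 2 ^ F v).
Proof.
by apply: elem_comp1; apply: (elem_of el_exp2) => v; rewrite (tnth_nth 0).
Qed.

Lemma elem_max n F G :
  elem n F -> elem n G -> elem n (fun v => maxn (F v) (G v)).
Proof.
by apply: elem_comp2; apply: (elem_of el_max) => v; rewrite !(tnth_nth 0).
Qed.

Lemma elem_const n c : elem n (fun=> c).
Proof.
elim: c => [|c]; last exact: elem_succ.
apply: eq_elem (elem_nth n n) => v nv.
by rewrite nth_default ?nv.
Qed.

(** The recursion variable heads the list and [Y v] is substituted for it at once, so one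
    application yields a function of [v] alone. *)
Lemma elem_rec n (Y G : seq nat -> nat) (H : nat -> nat -> seq nat -> nat)
    (J F : nat -> seq nat -> nat) :
  elem n Y -> elem n G ->
  elem n.+2 (fun w => H (nth 0 w 0) (nth 0 w 1) (behead (behead w))) ->
  elem n.+1 (fun w => J (nth 0 w 0) (behead w)) ->
  (forall v, F 0 v = G v) -> (forall y v, F y.+1 v = H y (F y v) v) ->
  (forall y v, size v = n -> F y v <= J y v) ->
  elem n (fun v => F (Y v) v).
Proof.
move=> EY EG EH EJ F0 FS FJ.
have EF : elem n.+1 (fun w => F (nth 0 w 0) (behead w)).
  apply: (el_bounded_rec EG EH EJ) => [v|y v|w] /=; rewrite ?F0 ?FS//.
  by apply: FJ; rewrite size_behead size_tuple.
pose Yv i := if i is i'.+1 then fun v => nth 0 v i' else Y.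
have /(elem_comp EF) : forall i, i < n.+1 -> elem n (Yv i).
  by case=> // i _; apply: elem_nth.
apply: eq_elem => v nv; congr F.
apply: (@eq_from_nth _ 0) => [|i]; first by rewrite size_behead size_mkseq nv.
rewrite size_behead size_mkseq => lt_in.
by rewrite nth_behead nth_mkseq.
Qed.

Ltac el_var :=
  first [ exact: (elem_var _ 0) | exact: (elem_var _ 1) | exact: (elem_var _ 2)
        | exact: (elem_var _ 3) | exact: (elem_var _ 4) ].

Lemma elem_add n F G : elem n F -> elem n G -> elem n (fun v => F v + G v).
Proof.
apply: elem_comp2.
apply: (@elem_rec 2 _ (fun v => nth 0 v 1) (fun _ r _ => r.+1)
  (fun y v => 2 ^ maxn y (nth 0 v 1)) (fun y v => y + nth 0 v 1)).
- exact: elem_nth.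
- exact: elem_nth.
- by apply: elem_succ; apply: elem_nth.
- by apply: elem_exp2; apply: elem_max; el_var.
- by [].
- by [].
(* If m + 1 is the larger of x and y, then x + y <= 2 (m + 1) <= 2 ^ (m + 1). *)
- move=> y v _; move: (nth _ _ _) => x.
  case def_m: (maxn y x) => [|m]; first by lia.
  have := ltn_expl m (ltnSn 1); rewrite expnS; lia.
Qed.

Lemma elem_mul n F G : elem n F -> elem n G -> elem n (fun v => F v * G v).
Proof.
apply: elem_comp2.
apply: (@elem_rec 2 _ (fun=> 0) (fun _ r v => r + nth 0 v 1)
  (fun y v => 2 ^ (y + nth 0 v 1)) (fun y v => y * nth 0 v 1)).
- exact: elem_nth.
- exact: elem_const.
- by apply: elem_add; el_var.
- by apply: elem_exp2; apply: elem_add; el_var.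
- by [].
- by move=> y v; rewrite mulSn addnC.
- by move=> y v _; rewrite expnD leq_mul// ltnW// ltn_expl.
Qed.

Lemma elem_exp n F G : elem n F -> elem n G -> elem n (fun v => F v ^ G v).
Proof.
(* The recursion runs on the exponent, hence the swapped arguments. *)
move=> EF EG; apply: (elem_comp2 (phi := fun x y => y ^ x)) => //.
apply: (@elem_rec 2 _ (fun=> 1) (fun _ r v => r * nth 0 v 1)
  (fun y v => 2 ^ (nth 0 v 1 * y)) (fun y v => nth 0 v 1 ^ y)).
- exact: elem_nth.
- exact: elem_const.
- by apply: elem_mul; el_var.
- by apply: elem_exp2; apply: elem_mul; el_var.
- by [].
- by move=> y v; rewrite expnSr.
- by case=> [|y] v _; rewrite ?muln0// expnM leq_exp2r// ltnW// ltn_expl.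
Qed.

Lemma elem_pred n F : elem n F -> elem n (fun v => (F v).-1).
Proof.
apply: elem_comp1.
apply: (@elem_rec 1 _ (fun=> 0) (fun y _ _ => y) (fun y _ => y) (fun y _ => y.-1)).
- exact: elem_nth.
- exact: elem_const.
- el_var.
- el_var.
- by [].
- by [].
- by move=> y v _; apply: leq_pred.
Qed.

Lemma elem_sub n F G : elem n F -> elem n G -> elem n (fun v => F v - G v).
Proof.
move=> EF EG; apply: (elem_comp2 (phi := fun x y => y - x)) => //.
apply: (@elem_rec 2 _ (fun v => nth 0 v 1) (fun _ r _ => r.-1)
  (fun _ v => nth 0 v 1) (fun y v => nth 0 v 1 - y)).
- exact: elem_nth.
- exact: elem_nth.
- by apply: elem_pred; el_var.
- el_var.
- by move=> v; rewrite subn0.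
- by move=> y v; rewrite subnS.
- by move=> y v _; rewrite leq_subr.
Qed.

Lemma elemb_leq n F G : elem n F -> elem n G -> elem n (fun v => F v <= G v).
Proof.
move=> EF EG.
apply: eq_elem (elem_sub (elem_const n 1) (elem_sub EF EG)) => v _.
by case: leqP; lia.
Qed.

Lemma elemb_and n (P Q : seq nat -> bool) :
  elem n (fun v => P v) -> elem n (fun v => Q v) -> elem n (fun v => P v && Q v).
Proof. by move=> EP EQ; apply: eq_elem (elem_mul EP EQ) => v _; rewrite mulnb. Qed.

Lemma elemb_not n (P : seq nat -> bool) :
  elem n (fun v => P v) -> elem n (fun v => ~~ P v).
Proof.
by move=> EP; apply: eq_elem (elem_sub (elem_const n 1) EP) => v _; case: (P v).
Qed.

Lemma elemb_eq n F G : elem n F -> elem n G -> elem n (fun v => F v == G v).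
Proof.
move=> EF EG.
apply: eq_elem (elemb_and (elemb_leq EF EG) (elemb_leq EG EF)) => v _.
by rewrite eqn_leq.
Qed.

Lemma elem_if n (P : seq nat -> bool) F G :
  elem n (fun v => P v) -> elem n F -> elem n G ->
  elem n (fun v => if P v then F v else G v).
Proof.
move=> EP EF EG.
apply: eq_elem (elem_add (elem_mul EP EF) (elem_mul (elemb_not EP) EG)) => v _.
by case: (P v); rewrite !(mul1n, mul0n) ?addn0.
Qed.

Lemma elem_min n F G :
  elem n F -> elem n G -> elem n (fun v => minn (F v) (G v)).
Proof.
move=> EF EG; apply: eq_elem (elem_sub EF (elem_sub EF EG)) => v _; lia.
Qed.

(** * Domination by towers; bounded sums, products and maxima *)

Lemma leq_tower k x y : x <= y -> iter k (expn 2) x <= iter k (expn 2) y.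
Proof. by move=> le_xy; elim: k => //= k IH; rewrite leq_exp2l. Qed.

Lemma leq_towerl k l x : k <= l -> iter k (expn 2) x <= iter l (expn 2) x.
Proof.
move=> /subnKC <-; elim: (l - k) => [|m IH]; first by rewrite addn0.
by rewrite addnS; apply: leq_trans IH _; apply: ltnW; apply: ltn_expl.
Qed.

(* Elementary functions are dominated by towers of exponentials of fixed
   height; this is what makes bounded sums and products elementary. *)
Lemma elementary_tower n (F : n.-tuple nat -> nat) : elementary F ->
  exists k, forall v : n.-tuple nat,
    F v <= iter k (expn 2) (\max_(i < n) tnth v i).
Proof.
elim=> {n F}.
- by exists 1 => v /=; rewrite leq_exp2l// (leq_bigmax (F := tnth v)).
- by exists 0 => v /=; rewrite geq_max !(leq_bigmax (F := tnth v)).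
- by exists 0 => v.
- exists 1 => v /=; apply: leq_trans (ltn_expl _ (ltnSn 1)) _.
  by rewrite leq_exp2l// (leq_bigmax (F := tnth v)).
- by move=> n i; exists 0 => v /=; rewrite (leq_bigmax (F := tnth v)).
- move=> m n f g _ [kf Hf] _ /fin_all_exists[kg Hg].
  exists (kf + \max_(i < m) kg i) => v; apply: leq_trans (Hf _) _.
  rewrite iterD leq_tower//; apply/bigmax_leqP => i _; rewrite tnth_mktuple.
  by apply: leq_trans (Hg i v) (leq_towerl _ (leq_bigmax (F := kg) i)).
- move=> n g h j f _ _ _ _ _ [k Hk] _ _ Hj; exists k => v.
  exact: leq_trans (Hj v) (Hk v).
Qed.

Lemma elem_tower n k F : elem n F -> elem n (fun v => iter k (expn 2) (F v)).
Proof. by move=> EF; elim: k => //= k IH; apply: elem_exp2. Qed.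

(** The tower over the maximum of the arguments is monotone even when [F] is not, so it also
    dominates [F] at all smaller arguments. *)
Lemma elem_dominated n F : elem n F ->
  exists2 J : seq nat -> nat, elem n J &
    forall v w, size v = n -> size w = n ->
      (forall i, i < n -> nth 0 v i <= nth 0 w i) -> F v <= J w.
Proof.
move=> /elementary_tower[k Hk].
exists (fun v => iter k (expn 2) (\max_(i < n) nth 0 v i)).
  have Emax m : elem n (fun v => \max_(i < m) nth 0 v i).
    elim: m => [|m IH].
      by apply: eq_elem (elem_const n 0) => v _; rewrite big_ord0.
    by apply: eq_elem (elem_max IH (elem_nth n m)) => v _; rewrite big_ord_recr.
  exact: elem_tower.
move=> v w sv sw le_vw; have := Hk (tcast sv (in_tuple v)).
rewrite val_tcast => /leq_trans; apply; apply: leq_tower.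
apply/bigmax_leqP => i _; rewrite (tnth_nth 0) val_tcast /=.
by apply: leq_trans (le_vw _ (ltn_ord i)) _; apply: (leq_bigmax (F := fun i : 'I_n => nth 0 w i)).
Qed.

(** This bounds all terms of a sum, product or maximum at once, as the bound in [elem_rec]
    requires. *)
Lemma elem_bounded n (H : nat -> seq nat -> nat) :
  elem n.+1 (fun w => H (nth 0 w 0) (behead w)) ->
  exists2 J : nat -> seq nat -> nat,
    elem n.+1 (fun w => J (nth 0 w 0) (behead w)) &
    forall i y v, size v = n -> i <= y -> H i v <= J y v.
Proof.
move=> /elem_dominated[J EJ HJ]; exists (fun y v => J (y :: v)).
  by apply: eq_elem EJ => -[].
move=> i y v nv le_iy; apply: (HJ (i :: v) (y :: v)); rewrite /= ?nv//.
by case.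
Qed.

(** The step function of [elem_rec] also receives the previous value, in second position; here it is
    skipped. *)
Lemma elem_step n (H : nat -> seq nat -> nat) :
  elem n.+1 (fun w => H (nth 0 w 0) (behead w)) ->
  elem n.+2 (fun w => H (nth 0 w 0) (behead (behead w))).
Proof.
move=> EH; pose G i w := if i is i'.+1 then nth 0 w i'.+2 else nth 0 w 0.
have /(elem_comp EH) : forall i, i < n.+1 -> elem n.+2 (G i).
  by case=> [|i] _; apply: elem_nth.
apply: eq_elem => w sw; rewrite nth_mkseq//; congr H.
apply: (@eq_from_nth _ 0); rewrite !size_behead size_mkseq ?sw// => i lt_in.
by rewrite !nth_behead nth_mkseq.
Qed.

Lemma elem_sum n Y (H : nat -> seq nat -> nat) :
  elem n Y -> elem n.+1 (fun w => H (nth 0 w 0) (behead w)) ->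
  elem n (fun v => \sum_(0 <= i < Y v) H i v).
Proof.
move=> EY EH; have [J EJ HJ] := elem_bounded EH.
apply: (@elem_rec n Y (fun=> 0) (fun y r v => r + H y v)
  (fun y v => y * J y v) (fun y v => \sum_(0 <= i < y) H i v)) => //.
- exact: elem_const.
- by apply: elem_add; [el_var | exact: (elem_step EH)].
- by apply: elem_mul; first el_var.
- by move=> v; rewrite big_geq.
- by move=> y v; rewrite big_nat_recr.
- move=> y v nv; rewrite big_mkord; apply: (@leq_trans (\sum_(i < y) J y v)); last first.
    by rewrite sum_nat_const card_ord.
  by apply: leq_sum => i _; apply: HJ => //; apply: ltnW.
Qed.

Lemma elem_prod n Y (H : nat -> seq nat -> nat) :
  elem n Y -> elem n.+1 (fun w => H (nth 0 w 0) (behead w)) ->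
  elem n (fun v => \prod_(0 <= i < Y v) H i v).
Proof.
move=> EY EH; have [J EJ HJ] := elem_bounded EH.
apply: (@elem_rec n Y (fun=> 1) (fun y r v => r * H y v)
  (fun y v => J y v ^ y) (fun y v => \prod_(0 <= i < y) H i v)) => //.
- exact: elem_const.
- by apply: elem_mul; [el_var | exact: (elem_step EH)].
- by apply: elem_exp; last el_var.
- by move=> v; rewrite big_geq.
- by move=> y v; rewrite big_nat_recr.
- move=> y v nv; rewrite big_mkord; apply: (@leq_trans (\prod_(i < y) J y v)); last first.
    by rewrite prod_nat_const card_ord.
  by apply: leq_prod => i _; apply: HJ => //; apply: ltnW.
Qed.

Lemma elem_bigmax n Y (H : nat -> seq nat -> nat) :
  elem n Y -> elem n.+1 (fun w => H (nth 0 w 0) (behead w)) ->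
  elem n (fun v => \max_(0 <= i < Y v) H i v).
Proof.
move=> EY EH; have [J EJ HJ] := elem_bounded EH.
apply: (@elem_rec n Y (fun=> 0) (fun y r v => maxn r (H y v))
  J (fun y v => \max_(0 <= i < y) H i v)) => //.
- exact: elem_const.
- by apply: elem_max; [el_var | exact: (elem_step EH)].
- by move=> v; rewrite big_geq.
- by move=> y v; rewrite big_nat_recr.
- by move=> y v nv; rewrite big_mkord; apply/bigmax_leqP => i _; apply: HJ => //; apply: ltnW.
Qed.

(* Redefined whenever a new function has been shown elementary. *)
Ltac el_step := fail.
Ltac el := repeat (cbv beta;
  first [ exact: elem_const | el_var | eassumption | el_step
        | apply: elemb_leq | apply: elemb_eq | apply: elemb_and
        | apply: elemb_not | apply: elem_if
        | apply: elem_sum | apply: elem_prod | apply: elem_bigmax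
        | apply: elem_exp | apply: elem_mul | apply: elem_add
        | apply: elem_min | apply: elem_max | apply: elem_sub
        | apply: elem_pred | apply: elem_succ ]).

(** [F v] is the number of [i < B v] such that no [j <= i] satisfies [P], hence a bounded sum of
    bounded products. *)
Lemma elem_least n (P : nat -> seq nat -> bool) (B F : seq nat -> nat) :
  elem n.+1 (fun w => P (nth 0 w 0) (behead w)) -> elem n B ->
  (forall v, size v = n -> [/\ F v <= B v, P (F v) v &
     forall i, P i v -> F v <= i]) ->
  elem n F.
Proof.
move=> EP EB HF.
have EQ : elem n.+1 (fun w => \prod_(0 <= j < (nth 0 w 0).+1) ~~ P j (behead w)).
  apply: (@elem_prod n.+1 (fun w => (nth 0 w 0).+1)
    (fun j w => ~~ P j (behead w) : nat)); first by el.
  exact: (elem_step (H := fun i v => ~~ P i v : nat) (elemb_not EP)).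
have := elem_sum (H := fun i v => \prod_(0 <= j < i.+1) ~~ P j v) EB EQ.
apply: eq_elem => v nv; have [FB PF Fmin] := HF v nv.
rewrite big_mkord (eq_bigr (fun i : 'I_(B v) => (i < F v) : nat)) => [|i _].
  by rewrite -big_mkcond -(big_ord_widen _ (fun=> 1) FB) sum1_card card_ord.
rewrite big_mkord; have [lt_iF|le_Fi] := ltnP i (F v).
  rewrite big1// => j _; case: (boolP (P j v)) => // /Fmin.
  by rewrite leqNgt (leq_ltn_trans _ lt_iF)// -ltnS.
have lt_Fi : F v < i.+1 by [].
by rewrite (bigD1 (Ordinal lt_Fi))//= PF.
Qed.

(** * Division, divisibility, gcd and primality *)

Lemma elem_divn n F G : elem n F -> elem n G -> elem n (fun v => F v %/ G v).
Proof.
move=> EF EG; apply: (elem_comp2 (phi := divn)) => //.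
(* For divisor 0 the first conjunct fails, so the search stops at 0, in accordance with [divn]. *)
apply: (@elem_least 2 (fun q v => ~~ ((0 < nth 0 v 1) &&
  (nth 0 v 1 * q.+1 <= nth 0 v 0))) (fun v => nth 0 v 0)); [by el | by el|].
move=> v _; move: (nth 0 v 0) (nth 0 v 1) => m [|d]; first by rewrite divn0.
split=> [||q]; first exact: leq_div.
  by rewrite -ltnNge mulnC ltn_ceil.
by rewrite -ltnNge => lt_m; rewrite -ltnS ltn_divLR// mulnC.
Qed.

Lemma elem_modn n F G : elem n F -> elem n G -> elem n (fun v => F v %% G v).
Proof.
move=> EF EG; apply: (@eq_elem _ (fun v => F v - F v %/ G v * G v)).
  by move=> v _; rewrite {1}(divn_eq (F v) (G v)) addKn.
by apply: elem_sub => //; apply: elem_mul => //; apply: elem_divn.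
Qed.

Lemma elemb_dvdn n F G : elem n F -> elem n G -> elem n (fun v => F v %| G v).
Proof. by move=> EF EG; apply: elemb_eq (elem_modn EG EF) (elem_const n 0). Qed.

Lemma elem_half n F : elem n F -> elem n (fun v => (F v)./2).
Proof.
by move=> EF; apply: eq_elem (elem_divn EF (elem_const n 2)) => v _; rewrite divn2.
Qed.

Lemma elem_double n F : elem n F -> elem n (fun v => (F v).*2).
Proof.
by move=> EF; apply: eq_elem (elem_mul (elem_const n 2) EF) => v _; rewrite mul2n.
Qed.

Lemma elem_gcdn n F G : elem n F -> elem n G -> elem n (fun v => gcdn (F v) (G v)).
Proof.
(* The range extends to [F v + G v] because one argument may vanish; if both do, it contains only
   0. *)
move=> EF EG; apply: (@eq_elem _ (fun v =>
  \max_(0 <= d < (F v + G v).+1) if (d %| F v) && (d %| G v) then d else 0)).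
  move=> v _; rewrite big_mkord; apply/eqP; rewrite eqn_leq; apply/andP; split.
    apply/bigmax_leqP => -[d lt_d] _ /=; case: ifP => // /andP[dF dG].
    have [g_gt0|] := boolP (0 < gcdn (F v) (G v)); last first.
      rewrite gcdn_gt0 negb_or -!eqn0Ngt => /andP[/eqP F0 /eqP G0].
      by move: lt_d; rewrite F0 G0 ltnS leqn0 => /eqP->.
    by apply: dvdn_leq => //; rewrite dvdn_gcd dF.
  have lt_g : gcdn (F v) (G v) < (F v + G v).+1.
    case: (posnP (F v)) => [->|F0]; first by rewrite gcd0n.
    by rewrite ltnS (leq_trans (dvdn_leq F0 (dvdn_gcdl _ _)))// leq_addr.
  apply: leq_trans (leq_bigmax (Ordinal lt_g)).
  by rewrite /= dvdn_gcdl dvdn_gcdr.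
apply: (elem_comp2 (phi := fun x y =>
  \max_(0 <= d < (x + y).+1) if (d %| x) && (d %| y) then d else 0)) => //.
apply: elem_bigmax; first by el.
by apply: elem_if; [apply: elemb_and; apply: elemb_dvdn; el_var | el_var | el].
Qed.

Lemma elemb_prime n F : elem n F -> elem n (fun v => prime (F v)).
Proof.
move=> EF; apply: (@eq_elem _ (fun v => (1 < F v) &&
   (\sum_(0 <= d < F v) ((1 < d) && (d %| F v)) == 0) : nat)).
  move=> v _; congr nat_of_bool; move: (F v) => p.
  rewrite big_mkord sum_nat_eq0; apply/andP/primeP => [[p1 /forallP s0]|[p1 pr]]; split=> //.
    move=> d dp /=; have := dvdn_leq (ltnW p1) dp.
    rewrite leq_eqVlt => /orP[->|lt_dp]; first by rewrite orbT.
    have := s0 (Ordinal lt_dp); rewrite /= dp andbT eqb0 -leqNgt.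
    by have := dvdn_gt0 (ltnW p1) dp; lia.
  apply/forallP => d /=; rewrite eqb0; apply/negP => /andP[d1 /pr/=].
  by have := ltn_ord d; lia.
apply: (elem_comp1 (phi := fun x => (1 < x) &&
   (\sum_(0 <= d < x) ((1 < d) && (d %| x)) == 0) : nat)) => //.
apply: elemb_and; first by el.
apply: elemb_eq; last by el.
apply: elem_sum; first by el.
by apply: elemb_and; [el | apply: elemb_dvdn; el_var].
Qed.

Ltac el_step ::= first [ apply: elem_divn | apply: elem_modn | apply: elem_gcdn
  | apply: elem_half | apply: elem_double | apply: elemb_dvdn | apply: elemb_prime ].

(** * Primes and the tower function *)

Lemma next_primeP m : [/\ prime (next_prime m), m < next_prime m &
  forall p, prime p -> m < p -> next_prime m <= p].
Proof.
rewrite /next_prime; case: ex_minnP => p /andP[pp mp] pmin; split=> // q pq mq.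
by apply: pmin; rewrite pq.
Qed.

Lemma nth_primeS i : nth_prime i.+1 = next_prime (nth_prime i).
Proof. by []. Qed.

Lemma prime_nth_prime i : prime (nth_prime i).
Proof. by have [] := next_primeP (iter i next_prime 0). Qed.

Lemma nth_prime0 : nth_prime 0 = 2.
Proof.
have [_ _ /(_ 2 isT isT)] := next_primeP 0.
by have := prime_gt1 (prime_nth_prime 0); rewrite -[next_prime 0]/(nth_prime 0); lia.
Qed.

Lemma nth_prime_ltnS i : nth_prime i < nth_prime i.+1.
Proof. by have [] := next_primeP (nth_prime i). Qed.

Lemma nth_prime_mono : {mono nth_prime : i j / i < j}.
Proof. exact/leqW_mono/leq_mono/(homo_ltn ltn_trans nth_prime_ltnS). Qed.

Lemma ltn_nth_prime i : i < nth_prime i.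
Proof.
elim: i => [|i IH]; first exact: prime_gt0 (prime_nth_prime 0).
exact: leq_ltn_trans IH (nth_prime_ltnS i).
Qed.

(** No prime lies strictly between consecutive values of [nth_prime], so [q] is one of the
    factors. *)
Lemma prime_dvd_primorial i q : prime q -> q <= nth_prime i ->
  q %| \prod_(j < i.+1) nth_prime j.
Proof.
move=> pq; elim: i => [|i IH] qi; rewrite big_ord_recr/=.
  rewrite big_ord0 mul1n; move: qi; rewrite nth_prime0 => qi.
  by have -> : q = 2 by have := prime_gt1 pq; lia.
have [qi'|iq] := leqP q (nth_prime i); first by rewrite dvdn_mulr// IH.
rewrite dvdn_mull//; have [_ _ /(_ q pq iq)] := next_primeP (nth_prime i).
by rewrite -nth_primeS => ?; have -> : q = nth_prime i.+1 by lia.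
Qed.

(* Euclid's argument. *)
Lemma nth_prime_bound i : nth_prime i <= 2 ^ 2 ^ i.
Proof.
have euclid j : nth_prime j.+1 <= (\prod_(l < j.+1) nth_prime l).+1.
  set Q := \prod_(l < j.+1) nth_prime l; have Q_gt0 : 0 < Q.
    by apply: prodn_gt0 => l; rewrite prime_gt0// prime_nth_prime.
  apply: leq_trans (pdiv_leq (ltn0Sn Q)); rewrite nth_primeS.
  have pr : prime (pdiv Q.+1) by rewrite pdiv_prime.
  have [_ _] := next_primeP (nth_prime j); apply=> //.
  rewrite ltnNge; apply/negP => /(prime_dvd_primorial pr) dvQ.
  have : pdiv Q.+1 %| 1 by rewrite -(dvdn_addr _ dvQ) addn1 pdiv_dvd.
  by rewrite dvdn1 => /eqP E; rewrite E in pr.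
(* With Q the product so far and p <= Q + 1 the next prime, Q p + 1 <= (Q + 1) ^ 2, so the bound
   squares at each step. *)
have Qb j : (\prod_(l < j.+1) nth_prime l).+1 <= 2 ^ 2 ^ j.+1.
  elim: j => [|j IH].
    rewrite big_ord_recr big_ord0 /= mul1n.
    by rewrite nth_prime0.
  rewrite big_ord_recr /=; have := euclid j; move: IH.
  set Q := \prod_(_ < _) _; set p := nth_prime _ => Qle pQ.
  rewrite (expnSr _ j.+1) expnM; apply: (@leq_trans (Q.+1 ^ 2)).
    by rewrite -mulnn; nia.
  by rewrite leq_exp2r.
case: i => [|i]; first by rewrite nth_prime0.
exact: leq_trans (euclid i) (Qb i).
Qed.

Lemma elem_next_prime n F : elem n F -> elem n (fun v => next_prime (F v)).
Proof.
apply: elem_comp1.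
apply: (@elem_least 1 (fun p v => prime p && (nth 0 v 0 < p))
  (fun v => 2 ^ 2 ^ nth 0 v 0)); [by el | by el |].
move=> v _; move: (nth 0 v 0) => m; have [pr lt_m pmin] := next_primeP m.
split=> [||p /andP[]]; [|by rewrite pr | exact: pmin].
(* The m-th prime exceeds m, hence it is at least [next_prime m]. *)
apply: leq_trans (nth_prime_bound m).
by apply: pmin (prime_nth_prime m) (ltn_nth_prime m).
Qed.

Lemma elem_nth_prime n F : elem n F -> elem n (fun v => nth_prime (F v)).
Proof.
apply: elem_comp1.
apply: (@elem_rec 1 _ (fun=> nth_prime 0) (fun _ r _ => next_prime r)
  (fun y _ => 2 ^ 2 ^ y) (fun y _ => nth_prime y)); try by el.
- by apply: elem_next_prime; el.
- by move=> y _ _; apply: nth_prime_bound.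
Qed.

Ltac el_step ::= first [ apply: elem_divn | apply: elem_modn | apply: elem_gcdn
  | apply: elem_half | apply: elem_double | apply: elemb_dvdn | apply: elemb_prime | apply: elem_nth_prime ].

Lemma gtower_gt0 j : 0 < gtower j.
Proof. by case: j => //= j; rewrite expn_gt0 prime_gt0// prime_nth_prime. Qed.

(** This bound with an exponent linear in [gtower j] yields both the growth by a factor 4 and the
    estimate [sum_den_sqr]. *)
Lemma gtower_step j : nth_prime j ^ (3 * gtower j) <= gtower j.+1.
Proof.
rewrite [gtower j.+1]/= leq_exp2l ?prime_gt1 ?prime_nth_prime//.
apply: (@leq_trans (4 * (gtower j + 1) ^ 3)); last by rewrite leq_mul2r; lia.
by rewrite !expnS expn0; nia.
Qed.

Lemma gtower_growth j : 4 * gtower j <= gtower j.+1.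
Proof.
apply: leq_trans (gtower_step j).
have p1 := prime_gt1 (prime_nth_prime j).
apply: (@leq_trans (2 ^ (3 * gtower j))); last first.
  by rewrite leq_exp2r// muln_gt0 gtower_gt0.
have := gtower_gt0 j; case: (gtower j) => // g _.
by rewrite [3 * g.+1]mulnS expnD -[2 ^ 3]/8; have := ltn_expl (3 * g) (ltnSn 1); lia.
Qed.

Lemma gtower_ltnS j : gtower j < gtower j.+1.
Proof. by have := gtower_growth j; have := gtower_gt0 j; lia. Qed.

Lemma gtower_mono : {mono gtower : i j / i < j}.
Proof. exact/leqW_mono/leq_mono/(homo_ltn ltn_trans gtower_ltnS). Qed.

Lemma ltn_gtower j : j < gtower j.
Proof. by elim: j => [//|j IH]; apply: leq_ltn_trans IH (gtower_ltnS j). Qed.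

(** The recursion can be run on truncated values: once the tower has reached the cut-off y, the next
    step applied to y itself again gives at least y. *)
Lemma elem_min_gtower n F G :
  elem n F -> elem n G -> elem n (fun v => minn (gtower (F v)) (G v)).
Proof.
apply: (elem_comp2 (phi := fun j y => minn (gtower j) y)).
apply: (@elem_rec 2 _ (fun v => minn 1 (nth 0 v 1))
  (fun j r v => minn (nth_prime j ^ (2 * (j + 2) * (r + 1) ^ 3)) (nth 0 v 1))
  (fun _ v => nth 0 v 1) (fun j v => minn (gtower j) (nth 0 v 1))); try by el.
- move=> j v; move: (nth 0 v 1) => y; have [lt_gy|le_yg] := ltnP (gtower j) y.
    by [].
  have p1 := prime_gt1 (prime_nth_prime j).
  rewrite (minn_idPr (leq_trans le_yg (ltnW (gtower_ltnS j)))).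
  apply/esym/minn_idPr/(leq_trans (ltnW (ltn_expl y p1))).
  by rewrite leq_exp2l//; rewrite !expnS expn0; nia.
- by move=> j v _; apply: geq_minr.
Qed.

(** Recursion on the cut-off y. If the value r at y is below y, it is already f x; otherwise f x >=
    y, and the graph decides whether f x is y or larger. *)
Lemma elem_min_of_graph (f : nat -> nat) n F G :
  elementary_rel (fun x y => f x == y) ->
  elem n F -> elem n G -> elem n (fun v => minn (f (F v)) (G v)).
Proof.
move=> Ef.
have Eg m A B : elem m A -> elem m B -> elem m (fun v => f (A v) == B v).
  apply: (elem_comp2 (phi := fun x y => f x == y : nat)).
  by apply: (elem_of Ef) => v; rewrite !(tnth_nth 0).
move=> EF EG; apply: (elem_comp2 (phi := fun y x => minn (f x) y)) => //.
apply: (@elem_rec 2 _ (fun v => 0)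
  (fun y r v => if r < y then r else if f (nth 0 v 1) == y then y else y.+1)
  (fun y _ => y) (fun y v => minn (f (nth 0 v 1)) y)); try by el.
- apply: elem_if; [by el | by el |]; apply: elem_if; [|by el |by el].
  by apply: Eg; el.
- move=> y v; case: ifP => [|]; first lia.
  by case: ifP => /eqP; lia.
- by move=> y v _; apply: geq_minr.
Qed.

(** * Partial sums of the series *)

Section Series.
Variable f : nat -> nat.
Hypothesis f_le : forall x, f x <= f x.+1.
Hypothesis f_exp : forall x, 2 ^ x <= f x.

(** [term_den], [sum_den] and [sum_num] are a_j, M_n and N_n; the divisions in [sum_num] are exact
    by [term_den_dvd]. *)
Definition term_den (j : nat) : nat := nth_prime j ^ hexp f j.
Definition sum_den (n : nat) : nat := \prod_(0 <= j < n) term_den j.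
Definition sum_num (n : nat) : nat := \sum_(0 <= j < n) sum_den n %/ term_den j.

Lemma term_den_gt0 j : 0 < term_den j.
Proof. by rewrite expn_gt0 prime_gt0// prime_nth_prime. Qed.

Lemma sum_denS n : sum_den n.+1 = sum_den n * term_den n.
Proof. by rewrite /sum_den big_nat_recr. Qed.

Lemma sum_den_gt0 n : 0 < sum_den n.
Proof. by apply: prodn_gt0 => j; apply: term_den_gt0. Qed.

Lemma term_den_dvd j n : j < n -> term_den j %| sum_den n.
Proof.
elim: n => // n IH; rewrite ltnS leq_eqVlt sum_denS => /orP[/eqP->|/IH jn].
  exact: dvdn_mull.
exact: dvdn_mulr.
Qed.

Lemma sum_numS n : sum_num n.+1 = sum_num n * term_den n + sum_den n.
Proof.
rewrite {1}/sum_num big_nat_recr//= sum_denS mulnK ?term_den_gt0//; congr (_ + _).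
rewrite big_distrl /= !big_mkord; apply: eq_bigr => j _.
by rewrite [RHS]mulnC muln_divA ?term_den_dvd// mulnC.
Qed.

(** Since f is nondecreasing, f j + j grows by at least 1, so the tower climbs at least one step. *)
Lemma hexp_growth j : 4 * hexp f j <= hexp f j.+1.
Proof.
apply: leq_trans (gtower_growth _) _; rewrite /hexp.
rewrite leqNgt gtower_mono -leqNgt addnS ltnS leq_add2r; exact: f_le.
Qed.

Lemma hexp_gt2 j : 2 < hexp f j.
Proof.
have /ltn_geF : 1 < f j + j + 1 by have := f_exp j; have := expn_gt0 2 j; lia.
rewrite /hexp; case: (f j + j) => // m _.
have := gtower_growth m; have := gtower_gt0 m; lia.
Qed.

Lemma hexp_homo : {homo hexp f : i j / i < j}.
Proof.
apply: homo_ltn ltn_trans _ => j.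
by have := hexp_growth j; have := hexp_gt2 j; lia.
Qed.

Lemma hexp_mono : {mono hexp f : i j / i < j}.
Proof. exact/leqW_mono/leq_mono/hexp_homo. Qed.

Lemma ltn_hexp j : j < hexp f j.
Proof.
elim: j => [|j IH]; first exact: leq_trans (hexp_gt2 0).
by apply: leq_ltn_trans IH (hexp_homo (ltnSn j)).
Qed.

(** By induction, twice the sum up to and including h(n) is at most 3 h(n), which is below h(n +
    1). *)
Lemma sum_hexp n : 2 * \sum_(0 <= j < n) hexp f j <= hexp f n.
Proof.
elim: n => [|n IH]; first by rewrite big_geq.
by rewrite big_nat_recr//=; have := hexp_growth n; lia.
Qed.

Lemma sum_den_le q n : 0 < q -> (forall j, j < n -> nth_prime j <= q) ->
  sum_den n <= q ^ \sum_(0 <= j < n) hexp f j.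
Proof.
move=> q_gt0; elim: n => [|n IH] Hq; first by rewrite /sum_den !big_geq.
rewrite sum_denS big_nat_recr//= expnD leq_mul ?IH// => [j jn|].
  by apply: Hq; apply: ltnW.
by rewrite leq_exp2r ?Hq// (leq_trans _ (hexp_gt2 n)).
Qed.

(** M_(n+1) is at most P_n to the power h(0) + ... + h(n), and twice this exponent is at most 3
    h(n). As P_n <= P_(f(n) + n), [gtower_step] at f(n) + n bounds the square. *)
Lemma sum_den_sqr n : sum_den n ^ 2 <= hexp f n.
Proof.
case: n => [|n].
  by rewrite /sum_den big_geq//; have := hexp_gt2 0; lia.
have pn := prime_gt1 (prime_nth_prime n).
have le_p j : j < n.+1 -> nth_prime j <= nth_prime n.
  by move=> jn; rewrite leqNgt nth_prime_mono -leqNgt.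
have le_g : gtower (f n + n).+1 <= hexp f n.+1.
  rewrite /hexp leqNgt gtower_mono -leqNgt addnS ltnS leq_add2r; exact: f_le.
apply: leq_trans le_g; apply: leq_trans (gtower_step _).
apply: (@leq_trans (nth_prime n ^ (3 * hexp f n))); last first.
  rewrite leq_exp2r; last by rewrite muln_gt0 gtower_gt0.
  by rewrite leqNgt nth_prime_mono -leqNgt leq_addl.
apply: (@leq_trans ((nth_prime n ^ \sum_(0 <= j < n.+1) hexp f j) ^ 2)).
  by rewrite leq_exp2r// sum_den_le// ltnW.
rewrite -expnM leq_exp2l// big_nat_recr//=.
by have := sum_hexp n; lia.
Qed.

(** All factors are bounded by powers of P_n: 2 <= P_n, b <= P_n ^ b, and M_n has exponent at most
    h(n) / 2. The total 1 + b k + h(n) / 2 is less than h(n). *)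
Lemma term_den_dominates b k n : 2 * b * k + 2 < hexp f n ->
  2 * b ^ k * sum_den n < term_den n.
Proof.
move=> lt_h; have pn := prime_gt1 (prime_nth_prime n).
apply: (@leq_ltn_trans (nth_prime n ^ (1 + b * k + \sum_(0 <= j < n) hexp f j))).
  rewrite !expnD; apply: leq_mul; last first.
    apply: sum_den_le => [|j jn]; first exact: ltnW.
    by rewrite ltnW// nth_prime_mono.
  apply: leq_mul => //; rewrite expnM; case: k {lt_h} => // k.
  by rewrite leq_exp2r//; apply: ltnW; apply: ltn_expl.
by rewrite ltn_exp2l//; have := sum_hexp n; lia.
Qed.

Lemma coprime_sum_den m n : n <= m -> coprime (nth_prime m) (sum_den n).
Proof.
elim: n => [|n IH] nm; first by rewrite /sum_den big_geq// coprimen1.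
rewrite sum_denS coprimeMr IH ?(ltnW nm)//= coprimeXr//.
rewrite prime_coprime ?prime_nth_prime// dvdn_prime2 ?prime_nth_prime//.
by rewrite gtn_eqF// nth_prime_mono.
Qed.

(** Modulo P_n, the numerator N_(n+1) = N_n a_n + M_n is congruent to M_n, which is coprime to P_n;
    and b <= n < P_n. *)
Lemma sum_num_nondvd b k n : 0 < b -> b <= n ->
  ~~ (sum_den n.+1 %| b ^ k * sum_num n.+1).
Proof.
move=> b_gt0 bn; have pr := prime_nth_prime n.
have pden : nth_prime n %| term_den n.
  by rewrite dvdn_exp// (leq_trans _ (hexp_gt2 n)).
apply/negP => dvd; have : nth_prime n %| b ^ k * sum_num n.+1.
  by apply: dvdn_trans dvd; rewrite sum_denS dvdn_mull.
rewrite Euclid_dvdM// Euclid_dvdX// => /orP[/andP[/(dvdn_leq b_gt0)]|].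
  by rewrite leqNgt (leq_ltn_trans bn (ltn_nth_prime n)).
rewrite sum_numS dvdn_addr ?dvdn_mull//.
by apply/negP; rewrite -prime_coprime// coprime_sum_den.
Qed.

(** * Denominators and numerators from truncated exponents *)

Lemma hexp_level y :
  exists n, [/\ n <= y, y <= hexp f n & forall j, (hexp f j < y) = (j < n)].
Proof.
have ex : exists n, y <= hexp f n by exists y; apply: ltnW (ltn_hexp y).
exists (ex_minn ex); case: ex_minnP => n yn nmin; split=> //.
  by apply: nmin; apply: ltnW (ltn_hexp y).
move=> j; have [jn|nj] := ltnP j n.
  by apply/idP; rewrite ltnNge; apply/negP => /nmin; rewrite leqNgt jn.
apply/negbTE; rewrite -leqNgt; apply: leq_trans yn _.
by rewrite leqNgt hexp_mono -leqNgt.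
Qed.

Definition trunc_hexp (j y : nat) : nat := minn (hexp f j) y.
(** Because j < h(j), every index with h(j) < y lies below y. The test singles out these indices,
    and for them the truncated exponent is exact. *)
Definition trunc_den (y : nat) : nat :=
  \prod_(0 <= j < y)
    if trunc_hexp j y < y then nth_prime j ^ trunc_hexp j y else 1.
Definition trunc_num (y : nat) : nat :=
  \sum_(0 <= j < y)
    if trunc_hexp j y < y then trunc_den y %/ nth_prime j ^ trunc_hexp j y else 0.

Section Level.
Variables y n : nat.
Hypothesis le_ny : n <= y.
Hypothesis level : forall j, (hexp f j < y) = (j < n).

Let trunc_lt j : (trunc_hexp j y < y) = (j < n).
Proof. by rewrite /trunc_hexp -level; case: leqP; lia. Qed.

Let truncE j : j < n -> trunc_hexp j y = hexp f j.
Proof. by rewrite -level => /ltnW; apply/minn_idPl. Qed.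

Lemma trunc_denE : trunc_den y = sum_den n.
Proof.
rewrite /trunc_den /sum_den (big_cat_nat (n := n))//= -[RHS]muln1; congr (_ * _).
  by rewrite !big_mkord; apply: eq_bigr => j _; rewrite trunc_lt ltn_ord truncE.
rewrite big_nat_cond big1// => j; rewrite andbT trunc_lt => /andP[nj _].
by rewrite ltnNge nj.
Qed.

Lemma trunc_numE : trunc_num y = sum_num n.
Proof.
rewrite /trunc_num trunc_denE /sum_num (big_cat_nat (n := n))//= -[RHS]addn0; congr (_ + _).
  by rewrite !big_mkord; apply: eq_bigr => j _; rewrite trunc_lt ltn_ord truncE.
rewrite big_nat_cond big1// => j; rewrite andbT trunc_lt => /andP[nj _].
by rewrite ltnNge nj.
Qed.

End Level.

Hypothesis f_graph : elementary_rel (fun x y => f x == y).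

(** [f] too is available only in truncated form. If f j > y, both tower arguments are at least y, so
    both minima equal y. *)
Lemma elem_trunc_hexp n F G :
  elem n F -> elem n G -> elem n (fun v => trunc_hexp (F v) (G v)).
Proof.
move=> EF EG; apply: (@eq_elem _ (fun v =>
    minn (gtower (minn (f (F v)) (G v) + F v)) (G v))) => [v _|].
  rewrite /trunc_hexp /hexp; move: (F v) (G v) => j y.
  have [//|yf] := leqP (f j) y.
  have le_g m : y <= m -> y <= gtower m.
    by move=> ym; apply: leq_trans ym _; apply: ltnW (ltn_gtower m).
  by rewrite !(minn_idPr (le_g _ _))//; lia.
by apply: elem_min_gtower => //; apply: elem_add => //; apply: elem_min_of_graph.
Qed.

Lemma elem_trunc_den n F : elem n F -> elem n (fun v => trunc_den (F v)).
Proof.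
apply: elem_comp1; apply: elem_prod; first by el.
have E := elem_trunc_hexp (elem_var 2 0 0) (elem_var 2 1 0).
by el.
Qed.

Lemma elem_trunc_num n F : elem n F -> elem n (fun v => trunc_num (F v)).
Proof.
apply: elem_comp1; apply: elem_sum; first by el.
have E := elem_trunc_hexp (elem_var 2 0 0) (elem_var 2 1 0).
have E' := elem_trunc_den (elem_var 2 1 0).
by el.
Qed.

(** * Approximation of alpha by its partial sums *)

Section Real.
Variable R : realType.
Local Open Scope ring_scope.

Let S (n : nat) : R := \sum_(0 <= j < n) (term_den j)%:R^-1.

Let SS n : S n.+1 = S n + (term_den n)%:R^-1.
Proof. by rewrite /S big_nat_recr. Qed.

Lemma alpha_partialE n : alpha_partial R f n = S n.+1.
Proof. by apply: eq_bigr => j _; rewrite /term_den natrX. Qed.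

Lemma sum_ratio n : S n = (sum_num n)%:R / (sum_den n)%:R.
Proof.
have gt0 (m : nat) : (0 < m)%N -> m%:R != 0 :> R by rewrite pnatr_eq0 lt0n.
elim: n => [|n IH]; first by rewrite /S /sum_num !big_geq// mul0r.
rewrite SS IH sum_numS sum_denS natrD !natrM.
by field; rewrite !gt0 ?sum_den_gt0 ?term_den_gt0.
Qed.

Lemma term_denV_half n : 2 * (term_den n.+1)%:R^-1 <= (term_den n)%:R^-1 :> R.
Proof.
have gt0 j : 0 < (term_den j)%:R :> R by rewrite ltr0n term_den_gt0.
rewrite ler_pdivrMr// mulrC ler_pdivlMr// -natrM ler_nat.
have pn := prime_gt1 (prime_nth_prime n).
apply: (@leq_trans (nth_prime n ^ (hexp f n).+1)).
  by rewrite expnS leq_mul2r pn orbT.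
apply: (@leq_trans (nth_prime n ^ hexp f n.+1)).
  by rewrite leq_exp2l// hexp_mono.
by rewrite leq_exp2r ?(leq_trans _ (hexp_gt2 _))// ltnW// nth_prime_mono.
Qed.

(** Since each term is at most half the previous one, S m + 2 / a_m is nonincreasing in m, and it
    bounds all partial sums from above. *)
Lemma alpha_bounds n : S n <= alpha R f <= S n + 2 * (term_den n)%:R^-1.
Proof.
have pos j : 0 < (term_den j)%:R^-1 :> R by rewrite invr_gt0 ltr0n term_den_gt0.
have ap : alpha_partial R f = (fun n => S n.+1).
  by apply/boolp.funext => m; apply: alpha_partialE.
have nd : {homo S : i j / (i <= j)%N >-> i <= j}.
  by apply/nondecreasing_seqP => i; rewrite SS lerDl ltW.
have ub m : S (n + m) + 2 * (term_den (n + m))%:R^-1 <= S n + 2 * (term_den n)%:R^-1.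
  elim: m => [|m IH]; first by rewrite addn0.
  apply: le_trans IH; rewrite addnS SS -addrA lerD2l.
  by have := term_denV_half (n + m); lra.
have ubS m : S m <= S n + 2 * (term_den n)%:R^-1.
  apply: le_trans (nd _ _ (leq_addl n m)) _; apply: le_trans (ub m).
  by rewrite lerDl mulr_ge0// ltW.
have nda : {homo alpha_partial R f : i j / (i <= j)%N >-> i <= j}.
  by move=> i j ij; rewrite ap; apply: nd.
have cv : cvgn (alpha_partial R f).
  apply: nondecreasing_is_cvgn => //; exists (S n + 2 * (term_den n)%:R^-1).
  by move=> _ [m _ <-]; rewrite ap.
apply/andP; split.
  apply: le_trans (nondecreasing_cvgn_le nda cv n).
  by rewrite ap; apply: nd.
by apply: limr_le => //; apply: nearW => m; rewrite ap.
Qed.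

(** Integrality leaves a gap of at least 1 / M_n between b^k N_n / M_n and the next integer; the
    scaled tail 2 b^k / a_n is smaller than that. *)
Lemma floor_alpha (b k n : nat) : (2 * b ^ k * sum_den n < term_den n)%N ->
  ((b ^ k * sum_num n) %/ sum_den n)%:R <= b%:R ^+ k * alpha R f
    < ((b ^ k * sum_num n) %/ sum_den n)%:R + 1.
Proof.
move=> dom; have /andP[lo hi] := alpha_bounds n; rewrite sum_ratio in lo hi.
set N := sum_num n in lo hi *; set M := sum_den n in dom lo hi *.
set u := ((b ^ k * N) %/ M)%N.
set a := term_den n in dom hi.
have M_gt0 : 0 < M%:R :> R by rewrite ltr0n sum_den_gt0.
have a_gt0 : 0 < a%:R :> R by rewrite ltr0n term_den_gt0.
have u_lo : u%:R * M%:R <= b%:R ^+ k * N%:R :> R.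
  by rewrite -natrX -!natrM ler_nat leq_trunc_div.
have u_hi : b%:R ^+ k * N%:R + 1 <= (u%:R + 1) * M%:R :> R.
  rewrite -natrX -natrM !natr1 -natrM ler_nat.
  by rewrite ltn_ceil// sum_den_gt0.
have b_ge0 : 0 <= b%:R ^+ k :> R by rewrite exprn_ge0.
apply/andP; split.
  apply: le_trans (ler_wpM2l b_ge0 lo).
  by rewrite mulrA ler_pdivlMr.
apply: le_lt_trans (ler_wpM2l b_ge0 hi) _.
rewrite mulrDr -(ltr_pM2r M_gt0) mulrDl.
have -> : b%:R ^+ k * (N%:R / M%:R) * M%:R = b%:R ^+ k * N%:R :> R.
  by rewrite mulrA divfK ?gt_eqF.
apply: lt_le_trans u_hi; rewrite ltrD2l.
rewrite mulrCA -!mulrA [_^-1 * _]mulrC !mulrA ltr_pdivrMr// mul1r.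
by rewrite -natrX -!natrM ltr_nat.
Qed.

End Real.

End Series.

(** [rat_code] sees the reduced fraction; its numerator is nonnegative, so [int_code] doubles it. *)
Lemma rat_code_ratio (d m : nat) : 0 < m ->
  rat_code (d%:R / m%:R) = cantor_pair (d %/ gcdn d m).*2 (m %/ gcdn d m).
Proof.
move=> m_gt0; set g := gcdn d m; have g_gt0 : 0 < g by rewrite gcdn_gt0 m_gt0 orbT.
set d' := d %/ g; set m' := m %/ g.
have dE : d = d' * g by rewrite divnK// dvdn_gcdl.
have mE : m = m' * g by rewrite divnK// dvdn_gcdr.
have m'_gt0 : 0 < m' by move: m_gt0; rewrite mE muln_gt0 => /andP[].
have cop : coprime d' m'.
  by rewrite /coprime -(eqn_pmul2r g_gt0) muln_gcdl -dE -mE mul1n.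
have -> : (d%:R / m%:R = (d'%:Z)%:~R / (m'%:Z)%:~R :> rat)%R.
  rewrite dE mE !natrM -mulf_div divff ?mulr1// pnatr_eq0; lia.
rewrite /rat_code coprimeq_num//= coprimeq_den//=.
rewrite gtr0_sg ?ltz_nat// mul1r.
by have -> : (Posz m' == 0%R) = false by lia.
Qed.

(** * Enumeration of the nonzero digits *)

Section Digits.
Variables (R : realType) (b : nat) (x : R) (u : nat -> nat).
Hypothesis b_ge2 : 2 <= b.
Hypothesis u_floor :
  forall k, ((u k)%:R <= b%:R ^+ k * x < (u k)%:R + 1)%R.

(** As [u k] is the floor of b^k x, [u k %% b] is the digit at position k. Counting starts at
    position 1, after the integer part. *)
Definition digit_count (k : nat) : nat := \sum_(0 <= j < k) (u j.+1 %% b != 0).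

Lemma digit_countS k : digit_count k.+1 = digit_count k + (u k.+1 %% b != 0).
Proof. by rewrite /digit_count big_nat_recr. Qed.

Lemma leq_digit_count : {homo digit_count : i j / i <= j}.
Proof. by apply: homo_leq leq_trans _ => // k; rewrite digit_countS leq_addr. Qed.

Lemma floor_unique k v : (v%:R <= b%:R ^+ k * x < v%:R + 1)%R -> v = u k.
Proof.
move=> /andP[lo hi]; have /andP[lo' hi'] := u_floor k.
have := le_lt_trans lo hi'; have := le_lt_trans lo' hi.
by rewrite !natr1 !ltr_nat; lia.
Qed.

(** The quotient [u k.+1 %/ b] satisfies the inequalities that determine the floor of b^k x. *)
Lemma floor_digit k : u k.+1 = u k * b + u k.+1 %% b.
Proof.
suff E : u k.+1 %/ b = u k by rewrite {1}(divn_eq (u k.+1) b) E.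
have b_gt0 : (0 < b%:R :> R)%R by rewrite ltr0n; lia.
apply: floor_unique; have := u_floor k.+1; rewrite exprS -mulrA.
move: (_ * x)%R => y /andP[lo hi]; apply/andP; split.
  rewrite -(ler_pM2l b_gt0); apply: le_trans lo.
  by rewrite -natrM ler_nat mulnC leq_trunc_div.
rewrite -(ltr_pM2l b_gt0); apply: lt_le_trans hi _.
by rewrite !natr1 -natrM ler_nat mulnC ltn_ceil//; lia.
Qed.

Lemma floor_no_digit k m : digit_count (k + m) = digit_count k ->
  u (k + m) = u k * b ^ m.
Proof.
elim: m => [|m IH]; rewrite ?addn0 ?muln1// addnS digit_countS => E.
have le := leq_digit_count (leq_addr m k).
rewrite floor_digit IH; last by lia.
have -> : u (k + m).+1 %% b = 0 by case: eqP E => // _; lia.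
by rewrite addn0 expnSr mulnA.
Qed.

Hypothesis u0 : u 0 = 0.
Variable K : nat -> nat.
Hypothesis K_count : forall i, i <= digit_count (K i).

Let digit_pos_ex i : exists k, i <= digit_count k.
Proof. by exists (K i). Qed.

Definition digit_pos i := ex_minn (digit_pos_ex i).

Lemma digit_posP i : [/\ digit_pos i <= K i, i <= digit_count (digit_pos i) &
  forall k, i <= digit_count k -> digit_pos i <= k].
Proof.
rewrite /digit_pos; case: ex_minnP => k ik kmin; split=> //; exact: kmin.
Qed.

Lemma digit_pos0 : digit_pos 0 = 0.
Proof. by have [_ _ /(_ 0 isT)] := digit_posP 0; lia. Qed.

(** By minimality the count passes from i to i + 1 exactly at the new position, so the digit there
    is nonzero. *)
Lemma digit_posS i : exists k, [/\ digit_pos i.+1 = k.+1, digit_count k = i,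
  digit_pos i <= k & u k.+1 %% b != 0].
Proof.
have [_ ge_i min_i] := digit_posP i.+1.
have [_ _ min_i'] := digit_posP i.
case E: (digit_pos i.+1) => [|k] in ge_i min_i *.
  by rewrite /digit_count big_geq in ge_i.
have lt_k : digit_count k < i.+1.
  by rewrite ltnNge; apply/negP => /min_i; rewrite ltnn.
exists k; move: ge_i; rewrite digit_countS; case: (u k.+1 %% b != 0) => /= ge_i.
  by split=> //; [lia | apply: min_i'; lia].
lia.
Qed.

Lemma digit_count_pos i : digit_count (digit_pos i) = i.
Proof.
case: i => [|i]; first by rewrite digit_pos0 /digit_count big_geq.
have [k [-> ck _ dk]] := digit_posS i.
by rewrite digit_countS dk ck addn1.
Qed.

Lemma leq_digit_pos i : i <= digit_pos i.
Proof.
elim: i => // i IH; have [k [-> _ ik _]] := digit_posS i.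
by rewrite ltnS (leq_trans IH).
Qed.

(** Between consecutive positions all digits vanish, so the floor is merely multiplied by a power of
    b; the partial sums are therefore truncations of x. *)
Lemma sum_digits n : (\sum_(1 <= i < n.+1)
    ((u (digit_pos i) %% b)%:R * b%:R ^- digit_pos i) =
  (u (digit_pos n))%:R * b%:R ^- digit_pos n :> R)%R.
Proof.
have bX m : (b%:R ^+ m != 0 :> R)%R.
  by rewrite expf_neq0// pnatr_eq0; lia.
elim: n => [|n IH]; first by rewrite big_geq// digit_pos0 u0 mul0r.
rewrite big_nat_recr//= IH; have [k [-> ck nk dk]] := digit_posS n.
have := @floor_no_digit (digit_pos n) (k - digit_pos n).
rewrite subnKC// ck digit_count_pos => /(_ erefl) uk.
rewrite [in RHS]floor_digit natrD natrM mulrDl uk; congr (_ + _)%R.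
have [m ->] : exists m, k = digit_pos n + m by exists (k - digit_pos n); rewrite subnKC.
rewrite addKn natrM natrX exprS exprD; field.
by rewrite !bX pnatr_eq0; lia.
Qed.

Lemma sum_approx_digits : is_sum_approx_below b x
  (fun i => (u (digit_pos i) %% b)%:R * b%:R ^- digit_pos i)%R.
Proof.
exists (fun i => u (digit_pos i) %% b), digit_pos; split.
- case=> // i _; have [k [-> _ _ dk]] := digit_posS i.
  by have : u k.+1 %% b < b by [rewrite ltn_mod; lia]; lia.
- split=> [|i _]; last by have [k [-> _ ? _]] := digit_posS i.
  by have [k [->]] := digit_posS 0.
- rewrite (_ : (fun n => _) =
    (fun n => (u (digit_pos n))%:R * b%:R ^- digit_pos n)%R); last first.
    by apply/boolp.funext => n; apply: sum_digits.
  have b_gt0 m : (0 < b%:R ^+ m :> R)%R by rewrite exprn_gt0// ltr0n; lia.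
  (* The truncation error is at most b to the power minus [digit_pos n], hence at most 2^-n, because
     [digit_pos n] is at least n. *)
  apply: (@squeeze_cvgr _ _ _ _ (fun n => x - 2^-1 ^+ n)%R (fun=> x)).
  + apply: nearW => n; have := u_floor (digit_pos n).
    move: (leq_digit_pos n); move: (digit_pos n) => k nk /andP[lo hi].
    rewrite ler_pdivrMr// [(x * _)%R]mulrC lo andbT ler_pdivlMr// mulrBl.
    rewrite lerBlDr mulrC; apply: le_trans (ltW hi) _; rewrite lerD2l.
    rewrite exprVn mulrC ler_pdivlMr ?exprn_gt0// mul1r -!natrX ler_nat.
    by apply: leq_trans (leq_pexp2l _ nk) _ => //; case: (k) => // k'; rewrite leq_exp2r.
  + rewrite -[X in (_ --> X)%classic]subr0; apply: cvgB; first exact: cvg_cst.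
    by apply: cvg_expr; rewrite ger0_norm; lra.
  + exact: cvg_cst.
- by split=> //; rewrite digit_pos0 u0 mod0n mul0r.
Qed.

Lemma elem_digit_pos n F : elem 1 (fun v => u (nth 0 v 0)) ->
  elem 1 (fun v => K (nth 0 v 0)) -> elem n F ->
  elem n (fun v => digit_pos (F v)).
Proof.
move=> Eu EK; apply: elem_comp1.
apply: (@elem_least 1 (fun k v => nth 0 v 0 <= digit_count k)
  (fun v => K (nth 0 v 0))) => //.
- rewrite /digit_count; apply: elemb_leq; first by el.
  apply: elem_sum; first by el.
  apply: elemb_not; apply: elemb_eq; last by el.
  apply: elem_modn; last by el.
  by apply: (elem_comp1 Eu); el.
- by move=> v _; have [] := digit_posP (nth 0 v 0).
Qed.

End Digits.

(** * Elementary digits, search bound and coded approximation *)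

Theorem theorem1 (R : realType) (f : nat -> nat) (b : nat) :
  honest f -> (2 <= b)%N ->
  exists A : nat -> rat,
    is_sum_approx_below b (alpha R f) A /\ elementary_rat_fun A.
Proof.
move=> [f_le f_exp f_graph] b_ge2.
pose u k := (b ^ k * trunc_num f (2 * b * k + 3)) %/ trunc_den f (2 * b * k + 3).
(* The summand [(hexp f b).+1] forces n > b at this level; the square makes h(n) large enough for
   the digits up to position i M_n to be those of N_n / M_n. *)
pose K i := i * trunc_den f ((2 * b * i + 3) ^ 2 + (hexp f b).+1).
have u_floor k : ((u k)%:R <= b%:R ^+ k * alpha R f < (u k)%:R + 1)%R.
  have [n [ny yh lvl]] := hexp_level f_le f_exp (2 * b * k + 3).
  rewrite /u (trunc_denE ny lvl) (trunc_numE ny lvl).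
  by apply: floor_alpha => //; apply: term_den_dominates => //; lia.
(* The floor may be computed from any sufficiently large n, so a single n serves all positions up to
   i M_n. *)
have uE k n : 2 * b * k + 2 < hexp f n ->
    u k = (b ^ k * sum_num f n) %/ sum_den f n.
  move=> kh; apply/esym; apply: (floor_unique b_ge2 u_floor).
  by apply: floor_alpha => //; apply: term_den_dominates.
have u0 : u 0 = 0.
  rewrite (uE 0 0) ?muln0 ?hexp_gt2//.
  by rewrite /sum_num big_geq// muln0 div0n.
have K_count i : i <= digit_count b u (K i).
  rewrite /K; set y := _ + _; have [n [ny yh lvl]] := hexp_level f_le f_exp y.
  rewrite (trunc_denE ny lvl).
  have bn : b < n by rewrite -lvl /y; lia.
  case: n => [//|n] in ny yh lvl bn *; set M := sum_den f n.+1.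
  have M_gt0 : 0 < M by apply: sum_den_gt0.
  have M_sqr : M ^ 2 <= hexp f n.+1 by apply: sum_den_sqr.
  (* With s = 2 b i + 3, the left side is below s M, which is at most the larger of s ^ 2 and M ^ 2;
     both are bounded by h. *)
  have range k : k <= i * M -> 2 * b * k + 2 < hexp f n.+1.
    move=> ki; apply: (@leq_trans ((2 * b * i + 3) * M)).
      by have : b * k <= b * (i * M) by [rewrite leq_mul2l ki orbT]; lia.
    have le_y : (2 * b * i + 3) ^ 2 <= hexp f n.+1.
      by apply: leq_trans yh; rewrite leq_addr.
    move: M_sqr le_y; rewrite -!mulnn; move: (2 * b * i + 3) => s M_sqr le_y.
    have [sM|Ms] := leqP s M.
      by apply: leq_trans M_sqr; rewrite leq_mul2r sM orbT.
    by apply: leq_trans le_y; rewrite leq_mul2l (ltnW Ms) orbT.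
  (* Each block of M consecutive positions contributes at least one nonzero digit. *)
  suff H t : t <= i -> t <= digit_count b u (t * M) by exact: H.
  elim: t => // t IH ti; have {}IH := IH (ltnW ti).
  apply: leq_ltn_trans IH _; rewrite mulSnr ltn_neqAle.
  rewrite leq_digit_count ?leq_addr// andbT; apply/negP => /eqP/esym E.
  have le_k : t * M + M <= i * M by rewrite -mulSnr leq_mul2r ti orbT.
  have := floor_no_digit b_ge2 u_floor E.
  rewrite !(uE _ n.+1) ?range ?(leq_trans (leq_addr _ _) le_k)// -/M.
  have := sum_num_nondvd f_exp (t * M) (ltnW b_ge2) bn.
  rewrite -/M expnD; move: (b ^ (t * M)) (sum_num f n.+1) => B N.
  rewrite /dvdn -lt0n => r_gt0 /eqP; apply/negP; rewrite gtn_eqF//.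
  (* Without a nonzero digit in the block, the floor would just be multiplied by b ^ M. But the
     remainder r >= 1 adds r b ^ M >= M to the numerator, hence at least 1 to the quotient. *)
  rewrite leq_divRL// [B * _ * N]mulnAC [in leqRHS](divn_eq (B * N) M).
  have le_M : M <= b ^ M by apply/ltnW/ltn_expl.
  move: r_gt0 le_M; move: (_ %/ _) (_ %% _) (b ^ M) => q r X r_gt0 le_M.
  by have : X <= r * X by [rewrite leq_pmull]; lia.
pose pos := digit_pos K_count.
exists (fun i => (u (pos i) %% b)%:R * b%:R ^- pos i)%R; split.
  exact: sum_approx_digits.
have Eu n F : elem n F -> elem n (fun v => u (F v)).
  apply: elem_comp1; apply: elem_divn; first apply: elem_mul; first by el.
    by apply: elem_trunc_num => //; el.
  by apply: elem_trunc_den => //; el.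
have EK : elem 1 (fun v => K (nth 0 v 0)).
  by apply: elem_mul; [el | apply: elem_trunc_den => //; el].
have Epos : elem 1 (fun v => pos (nth 0 v 0)).
  by apply: elem_digit_pos => //; [apply: Eu; el | el].
have : elem 1 (fun v => rat_code
   ((u (pos (nth 0 v 0)) %% b)%:R * b%:R ^- pos (nth 0 v 0))%R).
  apply: (@eq_elem _ (fun v => let k := pos (nth 0 v 0) in
     let d := u k %% b in let g := gcdn d (b ^ k) in
     cantor_pair (d %/ g).*2 (b ^ k %/ g))) => [v _ /=|].
    by rewrite -natrX rat_code_ratio// expn_gt0; lia.
  cbv zeta; rewrite /cantor_pair.
  have Ed : elem 1 (fun v => u (pos (nth 0 v 0)) %% b) by apply: elem_modn; [apply: Eu | el].
  have Eb : elem 1 (fun v => b ^ pos (nth 0 v 0)) by apply: elem_exp; el.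
  by el.
rewrite /elem /elementary_rat_fun /elementary_fun; congr elementary.
by apply/boolp.funext => v; rewrite (tnth_nth 0).
Qed.
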